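(* The set $$S^E=\Big\{(x,y,w)\in\mathbb{R}^{n}_+\times\mathbb{R}^n_+\times\mathbb{R}^n_+ : \sum_{i\in N}w_i\ge 1,\ \ w_i\le l_i^{k}(x_i,y_i)\ \ \forall\, k\in\bar K_i,\ \forall\, i\in N,\ \ x\le u\Big\}$$ is an extended formulation of $conv(S^U)$; that is, $\{(x,y) : \exists\, w \text{ with } (x,y,w)\in S^E\}=conv(S^U)$.
   Context: Let $n\ge 1$, $N=\{1,\dots,n\}$, $r>0$ a real number and $u=(u_1,\dots,u_n)$ a vector of positive integers. Define $$S^U=\Big\{(x,y)\in\mathbb{Z}^n_+\times\mathbb{R}^n_+ : \sum_{i=1}^n x_iy_i\ge r,\ x\le u\Big\},$$ where $\mathbb{R}_+=[0,\infty)$, $\mathbb{Z}_+=\mathbb{Z}\cap[0,\infty)$ and $x\le u$ is componentwise. $conv$ denotes convex hull. For $i\in N$ let $K_i=\{1,\dots,u_i\}$, $\bar K_i=K_i\cup\{u_i+1\}$ and $\bar u_i=r/u_i$. For $k\in K_i$ set $$l_i^{k}(x_i,y_i)=a_kx_i+b_ky_i,\qquad a_k=\frac{1}{2k-1},\quad b_k=\frac{k(k-1)}{r(2k-1)},$$ and set $l_i^{u_i+1}(x_i,y_i)=\dfrac{y_i}{\bar u_i}$. *)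

(* Defs.v *)
From HB Require Import structures.
From mathcomp Require Import all_boot all_order all_algebra.
From mathcomp Require Import boolp classical_sets reals convex.

Set Implicit Arguments.
Unset Strict Implicit.
Unset Printing Implicit Defensive.

Import Order.TTheory GRing.Theory Num.Theory.

Local Open Scope classical_set_scope.
Local Open Scope ring_scope.

Definition conv_hull (R : numDomainType) (E : lmodType R) (A : set E) : set E :=
  smallest (@convex_set R E) A.

(* Z^n_+ is embedded in R^n as the row vectors with entries in [Num.nat], so
   that the hull is taken in the real vector space R^n x R^n. *)
Definition SU (R : realType) (n : nat) (r : R) (u : 'I_n -> nat) :
    set ('rV[R]_n * 'rV[R]_n) :=
  [set p : 'rV[R]_n * 'rV[R]_n | let: (x, y) := p in
    [/\ forall i, x 0 i \is a Num.nat,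
        forall i, 0 <= y 0 i,
        \sum_i x 0 i * y 0 i >= r
      & forall i, x 0 i <= (u i)%:R]].

Definition coef_a (R : realType) (k : nat) : R := (2 * k%:R - 1)^-1.

Definition coef_b (R : realType) (r : R) (k : nat) : R :=
  k%:R * (k%:R - 1) / (r * (2 * k%:R - 1)).

Definition ubar (R : realType) (r : R) (m : nat) : R := r / m%:R.

(* [ell r m k] is l_i^k for an index i with u_i = m. It is only used for
   1 <= k <= m + 1. *)
Definition ell (R : realType) (r : R) (m k : nat) (s t : R) : R :=
  if (k == m.+1)%N then t / ubar r m else coef_a R k * s + coef_b r k * t.

Definition SE (R : realType) (n : nat) (r : R) (u : 'I_n -> nat) :
    set ('rV[R]_n * 'rV[R]_n * 'rV[R]_n) :=
  [set p : 'rV[R]_n * 'rV[R]_n * 'rV[R]_n | let: (x, y, w) := p in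
    [/\ [/\ forall i, 0 <= x 0 i, forall i, 0 <= y 0 i & forall i, 0 <= w 0 i],
        \sum_i w 0 i >= 1,
        forall i (k : nat), (1 <= k <= (u i).+1)%N ->
          w 0 i <= ell r (u i) k (x 0 i) (y 0 i)
      & forall i, x 0 i <= (u i)%:R]].

(* Main.v *)
Require Import Defs.
From HB Require Import structures.
From mathcomp Require Import all_boot all_order all_algebra.
From mathcomp Require Import boolp classical_sets reals convex.
From mathcomp Require Import interval_inference ring lra.

(** Both inclusions reduce to one index [i], writing [m] for [u_i].

    The projection is convex because the inequalities are linear, so it
    contains the hull as soon as it contains the generating points. There
    [x_i = j] is an integer and [w_i = min (1, x_i y_i / r)] works: in the
    tight case [x_i y_i = r], the [k]-th inequality amounts to
    [(j - k) (j - k + 1) >= 0], true because no integer lies strictly between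
    [k - 1] and [k] ([ell_ge_min]).

    Conversely, lower the [w_i] so that they sum to 1. The points with
    [x <= m] and [ell r m k x y >= 1] for all [k] form the convex hull of the
    points with integer abscissa in [1, m] on or above the hyperbola [x y = r],
    since for [2 <= k <= m] the line [ell r m k = 1] carries the chord of the
    hyperbola over [k - 1, k] ([conv_hull_piece]). By homogeneity, the bounds
    on [w_i] let [(x_i, y_i)] split as [w_i p_i + (1 - w_i) q_i], with [p_i] in
    this hull and [q_i] in the hull of the points of integer abscissa in
    [0, m] whose product is not constrained ([piece_box_decomposition]). Hence
    [(x, y)] is the combination, with weights [w_i], of the points [z_i] whose
    [i]-th coordinate is [p_i] and whose other coordinates are the [q_j]. Each
    [z_i] is in the hull of the feasible set, because a single coordinate with
    [x_i y_i >= r] already makes a point feasible ([SU_rows]) and because a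
    convex set containing a product of sets contains the product of their
    hulls ([conv_hull_prod]). *)

Set Implicit Arguments.
Unset Strict Implicit.
Unset Printing Implicit Defensive.

Import Order.TTheory GRing.Theory Num.Theory.

Local Open Scope classical_set_scope.
Local Open Scope ring_scope.

(** * Convex sets and hulls in real vector spaces *)

Section Convexity.
Variable R : realType.
Implicit Types E F : lmodType R.

Lemma convex_setP E (A : set E) :
  convex_set A <-> forall a b (t : R), 0 <= t <= 1 -> A a -> A b ->
    A (t *: a + (1 - t) *: b).
Proof.
split=> [cA a b t /andP[t0 t1] Aa Ab|cA a b t /set_mem Aa /set_mem Ab].
  by have := cA a b (Itv01 t0 t1) (mem_set Aa) (mem_set Ab); move/set_mem.
apply: mem_set; apply: cA => //.
by rewrite ge0 le1.
Qed.

Lemma convex_set_sum E (A : set E) (I : finType) (w : I -> R) (p : I -> E) :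
  convex_set A -> (forall i, 0 <= w i) -> \sum_i w i = 1 ->
  (forall i, A (p i)) -> A (\sum_i w i *: p i).
Proof.
move=> /convex_setP cA w0 w1 Ap.
(* Rescaled to total weight 1, the partial sums stay in [A]. *)
suff H s : 0 < \sum_(i <- s) w i ->
    A ((\sum_(i <- s) w i)^-1 *: \sum_(i <- s) w i *: p i).
  by have := H (index_enum I); rewrite w1 invr1 scale1r; apply.
elim: s => [|i s IH]; first by rewrite big_nil ltxx.
rewrite !big_cons; set W := \sum_(i <- s) w i; set P := \sum_(i <- s) _.
have : 0 <= W by apply: sumr_ge0.
rewrite le_eqVlt => /predU1P[W0|W_gt0 sum_gt0].
  (* A sum of zero total weight is itself zero, as each weight is nonnegative. *)
  have -> : P = 0.
    move: W0 => /esym/eqP; rewrite /W psumr_eq0// => /allP wz.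
    rewrite /P big_seq big1// => j js.
    by have /eqP -> := wz j js; rewrite scale0r.
  rewrite -W0 !addr0 => wi_gt0.
  by rewrite scalerA mulVf ?gt_eqF// scale1r.
have sum_neq0 : w i + W != 0 by rewrite gt_eqF.
have -> : (w i + W)^-1 *: (w i *: p i + P) =
    (w i / (w i + W)) *: p i + (1 - w i / (w i + W)) *: (W^-1 *: P).
  rewrite scalerDr !scalerA [_^-1 * w i]mulrC; congr (_ + _ *: P).
  have W_neq0 : W != 0 by rewrite gt_eqF.
  by field; rewrite W_neq0 sum_neq0.
apply: cA => //; last exact: IH.
by rewrite divr_ge0 ?(ltW sum_gt0)//= ler_pdivrMr// mul1r lerDl ltW.
Qed.

Lemma sub_conv_hull E (A : set E) : A `<=` conv_hull A.
Proof. exact: sub_gen_smallest. Qed.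

Lemma conv_hull_min E (A C : set E) :
  convex_set C -> A `<=` C -> conv_hull A `<=` C.
Proof. exact: smallest_sub. Qed.

Lemma convex_conv_hull E (A : set E) : convex_set (conv_hull A).
Proof.
apply/convex_setP => a b t t01 Aa Ab C [cC AC].
by move/convex_setP: (cC); apply=> //; [apply: (Aa C) | apply: (Ab C)].
Qed.

Lemma conv_hull_segment E (A : set E) a b (t : R) : 0 <= t <= 1 ->
  conv_hull A a -> conv_hull A b -> conv_hull A (t *: a + (1 - t) *: b).
Proof. exact: (iffLR (convex_setP _) (@convex_conv_hull E A)). Qed.

Lemma convex_preimage E F (f : E -> F) (C : set F) :
  (forall a b (t : R),
     f (t *: a + (1 - t) *: b) = t *: f a + (1 - t) *: f b) ->
  convex_set C -> convex_set (f @^-1` C).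
Proof.
move=> faff /convex_setP cC; apply/convex_setP => a b t t01 Ca Cb /=.
by rewrite faff; apply: cC.
Qed.

(** The hull can be taken one coordinate at a time: once the other coordinates
    are fixed, the values of one coordinate that keep the point in [C] form a
    convex set, being the preimage of [C] under an affine map. *)
Lemma conv_hull_prod E (I : finType) (A : I -> set E) (C : set {ffun I -> E}) :
  convex_set C ->
  (forall z : {ffun I -> E}, (forall i, A i (z i)) -> C z) ->
  forall z : {ffun I -> E}, (forall i, conv_hull (A i) (z i)) -> C z.
Proof.
move=> cC AC z hz.
suff H (s : seq I) (z' : {ffun I -> E}) :
    (forall i, if i \in s then conv_hull (A i) (z' i) else A i (z' i)) -> C z'.
  by apply: (H (enum I)) => i; rewrite mem_enum; exact: hz.
elim: s z' => [|j s IH] z' hz'; first exact: AC.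
pose f (e : E) : {ffun I -> E} := [ffun i => if i == j then e else z' i].
have fz' : f (z' j) = z'.
  by apply/ffunP => i; rewrite ffunE; case: eqP => // ->.
rewrite -fz'.
have /= := hz' j; rewrite mem_head.
apply: (@conv_hull_min _ _ (f @^-1` C)) => [|e Ae /=].
  apply: convex_preimage => // a b t.
  apply/ffunP => i; rewrite !ffunE; case: ifP => // _.
  by rewrite -scalerDl addrC subrK scale1r.
apply: IH => i; rewrite ffunE; case: eqP => [->|/eqP nij].
  by case: ifP => // _; exact: sub_conv_hull.
by have := hz' i; rewrite in_cons (negPf nij).
Qed.

End Convexity.

(** * The planar pieces *)

Section Planar.
Variable R : realType.
Implicit Types (x y w s t r : R) (m k j : nat).

Lemma le_ell r m k w s t : 0 < r -> (0 < k <= m)%N ->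
  (w <= ell r m k s t) =
  (w * (2 * k%:R - 1) <= s + k%:R * (k%:R - 1) * (t / r)).
Proof.
move=> r0 /andP[k0 km]; rewrite /ell ltn_eqF ?ltnS// /coef_a /coef_b.
have k1 : (1 : R) <= k%:R by rewrite ler1n.
have d0 : 0 < 2 * k%:R - 1 :> R by lra.
rewrite -ler_pdivlMr//; congr (_ <= _).
have r_neq0 : r != 0 by rewrite gt_eqF.
have d_neq0 : 2 * k%:R - 1 != 0 :> R by rewrite gt_eqF.
by field; rewrite r_neq0 d_neq0.
Qed.

Lemma le_ell_last r m w s t : 0 < r -> (0 < m)%N ->
  (w <= ell r m m.+1 s t) = (w * r <= m%:R * t).
Proof.
move=> r0 m0; rewrite /ell eqxx /ubar invf_div mulrA ler_pdivlMr//.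
by rewrite [t * _]mulrC.
Qed.

(** At [v = min (1, j y / r)] the [k]-th inequality with [k <= m], multiplied
    by [j], reads [v (2k - 1) j <= j^2 + k (k - 1) j y / r]. Since [j y / r >= v]
    and [1 >= v], it follows from [v (j - k) (j - k + 1) >= 0]. *)
Lemma ell_ge_min r m j k y : 0 < r -> (0 < m)%N -> (j <= m)%N -> 0 <= y ->
  (1 <= k <= m.+1)%N -> Num.min 1 (j%:R * y / r) <= ell r m k j%:R y.
Proof.
move=> r0 m0 jm y0 /andP[k1]; set v := Num.min _ _.
have T0 : 0 <= y / r by rewrite divr_ge0// ltW.
have v1 : v <= 1 by rewrite ge_min lexx.
have vT : v <= j%:R * (y / r) by rewrite mulrA ge_min lexx orbT.
have v0 : 0 <= v by rewrite le_min ler01 -mulrA mulr_ge0.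
rewrite leq_eqVlt ltnS => /predU1P[->|km].
  rewrite le_ell_last// -ler_pdivlMr// -mulrA (le_trans vT)//.
  by rewrite ler_wpM2r// ler_nat.
rewrite le_ell ?k1//; move: (y / r) T0 vT => T T0 vT.
have kk0 : 0 <= k%:R * (k%:R - 1) :> R.
  by rewrite mulr_ge0// subr_ge0 ler1n.
case: (posnP j) => [j_eq0|j_gt0].
  have -> : v = 0 by apply/eqP; rewrite eq_le v0 andbT (le_trans vT)// j_eq0 mul0r.
  by rewrite mul0r addr_ge0// mulr_ge0.
(* No integer lies strictly between [k - 1] and [k]. *)
have gap : 0 <= (j%:R - k%:R) * (j%:R - k%:R + 1) :> R.
  case: (leqP k j) => [kj|jk].
    have : (k%:R : R) <= j%:R by rewrite ler_nat.
    by move=> kj'; apply: mulr_ge0; lra.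
  have : (j.+1%:R : R) <= k%:R by rewrite ler_nat.
  by rewrite -natr1 => jk'; apply: mulr_le0; lra.
have j0 : 0 < j%:R :> R by rewrite ltr0n.
rewrite -(ler_pM2l j0).
have h1 : k%:R * (k%:R - 1) * v <= k%:R * (k%:R - 1) * (j%:R * T).
  exact: ler_wpM2l.
have h2 : v * (j%:R * j%:R) <= 1 * (j%:R * j%:R).
  by rewrite ler_wpM2r// mulr_ge0// ltW.
have h3 : 0 <= v * ((j%:R - k%:R) * (j%:R - k%:R + 1)) by rewrite mulr_ge0.
lra.
Qed.

Definition box m : set (R^o * R^o)%type :=
  [set p | [/\ p.1 \is a Num.nat, p.1 <= m%:R & 0 <= p.2]].

Definition piece r m : set (R^o * R^o)%type :=
  [set p | box m p /\ r <= p.1 * p.2].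

Lemma pair_combine (E := (R^o * R^o)%type : lmodType R) (t s a b c d : R) :
  t *: ((a, b) : E) + s *: ((c, d) : E) = (t * a + s * c, t * b + s * d) :> E.
Proof. by []. Qed.

Lemma conv_hull_box m x y : (0 < m)%N -> 0 <= x <= m%:R -> 0 <= y ->
  conv_hull (@box m) (x, y).
Proof.
move=> m0 /andP[x0 xm] y0.
have M0 : 0 < m%:R :> R by rewrite ltr0n.
have -> : (x, y) = (x / m%:R) *: ((m%:R, y) : R^o * R^o) +
    (1 - x / m%:R) *: ((0, y) : R^o * R^o).
  by rewrite pair_combine divfK ?gt_eqF// mulr0 addr0 -mulrDl addrC subrK mul1r.
apply: (conv_hull_segment (E := (R^o * R^o)%type)).
- by rewrite divr_ge0 ?(ltW M0)//= ler_pdivrMr// mul1r.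
- by apply: sub_conv_hull; split=> /=.
- by apply: sub_conv_hull; split=> /=.
Qed.

(** Between consecutive integers [k] and [k + 1], the inequality of index
    [k + 1] puts the point above a chord of the hyperbola; shifting the chord
    upwards to the point keeps its endpoints in [piece]. At [x = m] the
    inequality of index [m + 1] is the condition [m y >= r] itself. *)
Lemma conv_hull_piece r m x y : 0 < r -> (0 < m)%N -> 1 <= x <= m%:R ->
  (forall k, (1 <= k <= m.+1)%N -> 1 <= ell r m k x y) ->
  conv_hull (piece r m) (x, y).
Proof.
move=> r0 m0 /andP[x1 xm] hl.
have M0 : 0 < m%:R :> R by rewrite ltr0n.
have ym : r <= m%:R * y.
  by have := hl m.+1; rewrite le_ell_last// mul1r; apply; rewrite leqnn.
have y0 : 0 <= y by rewrite -(pmulr_rge0 _ M0) (le_trans (ltW r0)).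
pose k := Num.truncn x.
have /andP[kx xk] : k%:R <= x < k.+1%:R by apply: truncn_itv; lra.
have k0 : (0 < k)%N.
  by rewrite lt0n; apply/eqP => kz; move: xk; rewrite kz => ?; lra.
have K0 : 0 < k%:R :> R by rewrite ltr0n.
have km : (k <= m)%N by rewrite -(ler_nat R) (le_trans kx).
move: km; rewrite leq_eqVlt => /predU1P[km|km].
  have -> : x = m%:R by apply/eqP; rewrite eq_le xm -km kx.
  by apply: sub_conv_hull; split; first split=> /=.
have xk' : x <= k%:R + 1 by rewrite natr1 ltW.
(* [e] is the height of the point above the chord joining [(k, r / k)] and
   [(k + 1, r / (k + 1))]. *)
pose c j : R := r / j%:R.
pose e := y - ((k.+1%:R - x) * c k + (1 - (k.+1%:R - x)) * c k.+1).
have r_neq0 : r != 0 by rewrite gt_eqF.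
have k_neq0 : (k%:R : R) != 0 by rewrite gt_eqF.
have k1_neq0 : (k%:R + 1 : R) != 0 by rewrite natr1 pnatr_eq0.
have e0 : 0 <= e.
  have := hl k.+1; rewrite (leqW km) le_ell// => /(_ isT).
  rewrite mul1r -[k.+1%:R]natr1 => h.
  have -> : e = r / (k%:R * (k%:R + 1)) *
      (x + (k%:R + 1) * (k%:R + 1 - 1) * (y / r) - (2 * (k%:R + 1) - 1)).
    rewrite /e /c -!natr1; field.
    by rewrite r_neq0 k1_neq0 k_neq0.
  apply: mulr_ge0; last by rewrite subr_ge0.
  by apply: divr_ge0; apply: ltW => //; apply: mulr_gt0 => //; lra.
have pieceP j : (0 < j <= m)%N -> piece r m (j%:R, c j + e).
  move=> /andP[j0 jm]; split; first split=> //=.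
  - by rewrite ler_nat.
  - by rewrite addr_ge0// divr_ge0// ltW.
  rewrite mulrDr /c mulrCA divff ?pnatr_eq0 -?lt0n// mulr1 lerDl.
  by rewrite mulr_ge0.
have -> : (x, y) = (k.+1%:R - x) *: ((k%:R, c k + e) : R^o * R^o) +
    (1 - (k.+1%:R - x)) *: ((k.+1%:R, c k.+1 + e) : R^o * R^o).
  by rewrite pair_combine /e -!natr1; congr (_, _); ring.
apply: (conv_hull_segment (E := (R^o * R^o)%type)).
- by rewrite -natr1; apply/andP; split; lra.
- by apply: sub_conv_hull; apply: pieceP; rewrite k0 ltnW.
- by apply: sub_conv_hull; exact: (pieceP k.+1 km).
Qed.

(** For [w > 0] the candidate for [p] is [(x, y) / w], leaving [q = 0]. Its
    abscissa may exceed [m], since [x <= m] is not scaled by [w]; the surplus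
    then goes to [q]. *)
Lemma piece_box_decomposition r m x y w : 0 < r -> (0 < m)%N ->
  0 <= x <= m%:R -> 0 <= y -> 0 <= w <= 1 ->
  (forall k, (1 <= k <= m.+1)%N -> w <= ell r m k x y) ->
  exists p q : (R^o * R^o)%type,
    [/\ conv_hull (piece r m) p, conv_hull (@box m) q
      & (x, y) = w *: p + (1 - w) *: q].
Proof.
move=> r0 m0 /andP[x0 xm] y0 /andP[w0 w1] hl.
have M0 : 0 < m%:R :> R by rewrite ltr0n.
move: w0; rewrite le_eqVlt => /predU1P[w0|w0].
  (* [p] has weight zero, so any point of [piece] will do. *)
  exists (m%:R, r), (x, y); split.
  - apply: sub_conv_hull; split; first by split=> //=; rewrite ltW.
    by rewrite /= ler_peMl ?ler1n// ltW.
  - by apply: conv_hull_box; rewrite ?x0.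
  - by rewrite -w0 scale0r add0r subr0 scale1r.
have wn : w != 0 by rewrite gt_eqF.
(* The inequalities are homogeneous, so they hold with 1 at [(x, y) / w]. *)
have hl1 k s : x <= w * s -> (1 <= k <= m.+1)%N -> 1 <= ell r m k s (y / w).
  move=> xs /andP[k1]; rewrite leq_eqVlt ltnS => /predU1P[->|km].
    have := hl m.+1; rewrite leqnn !le_ell_last// mul1r => /(_ isT).
    by rewrite mulrA ler_pdivlMr// mulrC.
  have := hl k; rewrite k1 (leqW km) !le_ell ?k1// mul1r => /(_ isT) h.
  rewrite -(ler_pM2l w0) (le_trans h)// (mulrDr w) lerD//.
  by rewrite le_eqVlt; apply/orP; left; apply/eqP; field; rewrite wn gt_eqF.
have yE : w * (y / w) = y by rewrite mulrC divfK.
case: (leP (x / w) m%:R) => [xwm|mxw].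
  have xE : w * (x / w) = x by rewrite mulrC divfK.
  have hl2 k : (1 <= k <= m.+1)%N -> 1 <= ell r m k (x / w) (y / w).
    by apply: hl1; rewrite xE.
  exists (x / w, y / w), (0, 0); split.
  - apply: conv_hull_piece => //; rewrite xwm andbT.
    have := hl2 1%N; rewrite le_ell// subrr mulr0 mul0r addr0 => h.
    by have := h isT; lra.
  - by apply: conv_hull_box; rewrite ?lexx// ltW.
  - by rewrite pair_combine xE yE !mulr0 !addr0.
have wmx : w * m%:R < x by rewrite mulrC -ltr_pdivlMr.
have wlt1 : w < 1.
  by rewrite lt_neqAle w1 andbT; apply/eqP => w_eq1; move: wmx; rewrite w_eq1; lra.
have w'0 : 0 < 1 - w by lra.
(* The surplus [x - w m] is at most [(1 - w) m] because [x <= m]. *)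
exists (m%:R, y / w), ((x - w * m%:R) / (1 - w), 0); split.
- apply: sub_conv_hull; split; first by split=> //=; rewrite divr_ge0// ltW.
  have := hl m.+1; rewrite leqnn le_ell_last// => /(_ isT) h /=.
  by rewrite mulrA ler_pdivlMr// mulrC.
- apply: conv_hull_box => //; apply/andP; split.
    by rewrite divr_ge0 ?ltW// subr_gt0.
  by rewrite ler_pdivrMr//; lra.
- rewrite pair_combine yE mulr0 addr0; congr (_, _).
  by rewrite mulrC [(1 - w) * _]mulrC divfK ?gt_eqF// [m%:R * _]mulrC addrC subrK.
Qed.

End Planar.

(** * The extended formulation *)

Section Formulation.
Variables (R : realType) (n : nat) (r : R) (u : 'I_n -> nat).
Hypotheses (r_gt0 : 0 < r) (u_gt0 : forall i, (0 < u i)%N).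

Let plane : lmodType R := (R^o * R^o)%type.

Definition rows (z : {ffun 'I_n -> plane}) : 'rV[R]_n * 'rV[R]_n :=
  (\row_i (z i).1, \row_i (z i).2).

Lemma convex_rows (C : set ('rV[R]_n * 'rV[R]_n)) :
  convex_set C -> convex_set (rows @^-1` C).
Proof.
apply: convex_preimage => a b t; congr (_, _);
  by apply/rowP => i; rewrite !mxE !ffunE.
Qed.

Lemma ell_combine m k t (s1 t1 s2 t2 : R) :
  ell r m k (t * s1 + (1 - t) * s2) (t * t1 + (1 - t) * t2) =
  t * ell r m k s1 t1 + (1 - t) * ell r m k s2 t2.
Proof. by rewrite /ell; case: ifP => _; ring. Qed.

Lemma convex_SE_projection :
  convex_set [set xy : 'rV[R]_n * 'rV[R]_n | exists w, SE r u (xy, w)].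
Proof.
apply/convex_setP => -[x1 y1] [x2 y2] t /andP[t0 t1].
move=> [w1 [[x10 y10 w10] sw1 lw1 xu1]] [w2 [[x20 y20 w20] sw2 lw2 xu2]].
have t1' : 0 <= 1 - t by lra.
exists (t *: w1 + (1 - t) *: w2); split.
- by split=> i; rewrite !mxE; apply: addr_ge0; apply: mulr_ge0.
- rewrite (eq_bigr (fun i => t * w1 0 i + (1 - t) * w2 0 i)); last first.
    by move=> i _; rewrite !mxE.
  rewrite big_split/= -!mulr_sumr.
  have := ler_wpM2l t0 sw1; have := ler_wpM2l t1' sw2; lra.
- move=> i k hk; rewrite !mxE ell_combine.
  by apply: lerD; apply: ler_wpM2l => //; [apply: lw1|apply: lw2].
- move=> i; rewrite !mxE.
  have := ler_wpM2l t0 (xu1 i); have := ler_wpM2l t1' (xu2 i); lra.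
Qed.

Lemma SU_sub_SE_projection :
  SU r u `<=` [set xy | exists w, SE r u (xy, w)].
Proof.
move=> [x y] [xN y0 sxy xu].
have x0 i : 0 <= x 0 i by apply: natr_ge0.
have xy0 i : 0 <= x 0 i * y 0 i / r by rewrite divr_ge0 ?mulr_ge0// ltW.
pose w : 'rV[R]_n := \row_i Num.min 1 (x 0 i * y 0 i / r).
have w0 i : 0 <= w 0 i by rewrite mxE le_min ler01 xy0.
exists w; split=> //; last first.
  move=> i k hk; rewrite mxE; have := xu i.
  have /natrP[j ->] := xN i; rewrite ler_nat => ju.
  exact: ell_ge_min.
(* Either one weight reaches 1, or every weight is [x_i y_i / r] and the product
   constraint gives the sum. *)
case: (pselect (exists i, w 0 i = 1)) => [[i wi1]|nw1].
  by rewrite (bigD1 i)//= wi1 lerDl sumr_ge0.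
rewrite (eq_bigr (fun i => x 0 i * y 0 i / r)) => [|i _].
  by rewrite -mulr_suml ler_pdivlMr// mul1r.
rewrite mxE minElt; case: ltP => // h.
by case: nw1; exists i; rewrite mxE minElt h.
Qed.

(** The product constraint bounds a sum of nonnegative terms from below, so one
    coordinate can satisfy it alone. *)
Lemma SU_rows (z : {ffun 'I_n -> plane}) i :
  (forall j, if j == i then piece r (u j) (z j) else @box R (u j) (z j)) ->
  SU r u (rows z).
Proof.
move=> hz.
have bz j : @box R (u j) (z j) by have := hz j; case: ifP => // _ [].
split=> [j|j||j]; rewrite ?mxE; try by have [] := bz j.
have [_ ri] : piece r (u i) (z i) by have := hz i; rewrite eqxx.
rewrite (bigD1 i)//= !mxE (le_trans ri)// lerDl sumr_ge0// => j _.
by rewrite !mxE; have [zN _ z0] := bz j; rewrite mulr_ge0// natr_ge0.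
Qed.

Lemma SE_projection_sub_conv_hull :
  [set xy | exists w, SE r u (xy, w)] `<=` conv_hull (SU r u).
Proof.
move=> [x y] [w [[x0 y0 w0] sw lw xu]].
pose W := \sum_i w 0 i.
have W0 : 0 < W by rewrite (lt_le_trans ltr01).
(* Lowering the weights preserves every upper bound on them. *)
pose v i := w 0 i / W.
have v0 i : 0 <= v i by rewrite divr_ge0// ltW.
have v1 : \sum_i v i = 1 by rewrite -mulr_suml divff ?gt_eqF.
have vw i : v i <= w 0 i by rewrite ler_pdivrMr// ler_peMr.
have vle1 i : v i <= 1 by rewrite -v1 (bigD1 i)//= lerDl sumr_ge0.
have /choice[p /choice[q hpq]] : forall i, exists p, exists q : plane,
    [/\ conv_hull (piece r (u i)) p, conv_hull (@box R (u i)) q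
      & ((x 0 i, y 0 i) : plane) = v i *: p + (1 - v i) *: q].
  move=> i; apply: piece_box_decomposition => //.
  - by rewrite x0 xu.
  - by rewrite v0 vle1.
  - by move=> k hk; apply: le_trans (vw i) _; apply: lw.
(* Coordinate [j] of the combination is [p j] with weight [v j] and [q j] with
   the weight of all other indices, [1 - v j]. *)
pose z i : {ffun 'I_n -> plane} := [ffun j => if j == i then p j else q j].
pose zxy : {ffun 'I_n -> plane} := [ffun i => (x 0 i, y 0 i)].
have -> : (x, y) = rows zxy.
  by congr (_, _); apply/rowP => i; rewrite !mxE ffunE.
have -> : zxy = \sum_i v i *: z i.
  apply/ffunP => j; rewrite ffunE sum_ffunE.
  have [_ _ ->] := hpq j; rewrite (bigD1 j)//= !ffunE eqxx; congr (_ + _).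
  have -> : 1 - v j = \sum_(i | i != j) v i.
    by rewrite -v1 (bigD1 j)//= addrC addrK.
  rewrite scaler_suml; apply: eq_bigr => i ij.
  by rewrite !ffunE eq_sym (negPf ij).
have cSU := convex_rows (@convex_conv_hull _ _ (SU r u)).
apply: (convex_set_sum (A := rows @^-1` conv_hull (SU r u))) => // i.
apply: (conv_hull_prod
  (A := fun j => if j == i then piece r (u j) else @box R (u j))) => // [z' hz'|j].
  apply: sub_conv_hull; apply: (@SU_rows _ i) => j.
  by have := hz' j; case: ifP.
by rewrite ffunE; have [hp hq _] := hpq j; case: ifP.
Qed.

End Formulation.

Theorem proposition4 (R : realType) (n : nat) (r : R) (u : 'I_n -> nat)
    (n_ge1 : (1 <= n)%N) (r_gt0 : 0 < r) (u_gt0 : forall i, (0 < u i)%N) :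
  [set xy : 'rV[R]_n * 'rV[R]_n | exists w : 'rV[R]_n, SE r u (xy, w)]
  = conv_hull (SU r u).
Proof.
apply/seteqP; split; first exact: SE_projection_sub_conv_hull.
apply: conv_hull_min; first exact: convex_SE_projection.
exact: SU_sub_SE_projection.
Qed.
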